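(* Let $u$ be a bivariate linear functional, $L^{(a)}(z)=L^{(a)}_nz^n+\dots+L^{(a)}_{-m}z^{-m}$ with $L^{(a)}_nL^{(a)}_{-m}\ne0$, $n,m\in\{0,1,2,\dots\}$, $a\in\{1,2\}$, and let $\hat u^{(1)}=L^{(1)}(z_1)u$, $\hat u^{(2)}=u\,\overline{L^{(2)}(z_2)}$ be the two Christoffel transformations, where the Gram matrices $G,\hat G^{(1)},\hat G^{(2)}$ are quasidefinite. Put $\underline n:=\max(n,m)$. Then the connectors $$\omega^{(1)}_1=\hat S^{(1)}_1L^{(1)}(\Upsilon)S_1^{-1},\quad\omega^{(1)}_2=S_2(\hat S^{(1)}_2)^{-1},\quad\omega^{(2)}_1=S_1(\hat S^{(2)}_1)^{-1},\quad\omega^{(2)}_2=\hat S^{(2)}_2L^{(2)}(\Upsilon)S_2^{-1}$$ satisfy: (1) $\omega^{(1)}_1$ is upper triangular with only $2\underline n+1$ nonzero upper diagonals (the main diagonal and the first $2\underline n$ superdiagonals), i.e. $(\omega^{(1)}_1)_{k,j}=0$ unless $0\le j-k\le2\underline n$; (2) $\omega^{(1)}_2$ is lower unitriangular with only $2\underline n+1$ nonzero lower diagonals (the main diagonal and the first $2\underline n$ subdiagonals); (3) $\omega^{(2)}_1$ is lower unitriangular with only $2\underline n+1$ nonzero lower diagonals; (4) $\omega^{(2)}_2$ is upper triangular with only $2\underline n+1$ nonzero upper diagonals.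
   Context: Indices start at $0$. CMV sequence: $\chi(z)=[1,z^{-1},z,z^{-2},z^2,\dots]^\top$. $\Upsilon$ is the semi-infinite permutation matrix with $\Upsilon\chi(z)=z\chi(z)$, i.e. its nonzero entries, all equal to $1$, are $\Upsilon_{2k,2k+2}$, $\Upsilon_{1,0}$, $\Upsilon_{2k+3,2k+1}$ ($k\ge0$); $\Upsilon^{-1}=\Upsilon^\top$, and $L(\Upsilon)=\sum_jL_j\Upsilon^j$. A bivariate linear functional $u=u_{z_1,\bar z_2}$ is a (continuous) linear functional on the span of $f(z_1)\otimes\overline{g(z_2)}:=f(z_1)\overline{g(z_2)}$, $f,g\in\mathbb C[z,z^{-1}]$; $\langle f,g\rangle_u=\langle u,f(z_1)\otimes\overline{g(z_2)}\rangle$; Gram matrix $G_{k,l}=\langle\chi^{(k)},\chi^{(l)}\rangle_u$. Quasidefinite means all leading principal minors are nonzero; then there are unique factorizations $G=S_1^{-1}H(S_2^{-1})^\dagger$ with $S_1,S_2$ lower unitriangular and $H$ diagonal with nonzero entries. The perturbed functionals are $\langle\hat u^{(1)},f\otimes\bar g\rangle=\langle u,L^{(1)}f\otimes\bar g\rangle$, $\langle\hat u^{(2)},f\otimes\bar g\rangle=\langle u,f\otimes\overline{L^{(2)}g}\rangle$, with Gram matrices $\hat G^{(a)}=(\hat S^{(a)}_1)^{-1}\hat H^{(a)}\big((\hat S^{(a)}_2)^{-1}\big)^\dagger$ factorized in the same way. *)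

(* Defs.v *)
From HB Require Import structures.
From mathcomp Require Import all_boot all_order all_algebra.
From mathcomp Require Import finmap.
From mathcomp Require Import boolp classical_sets fsbigop reals.
From mathcomp Require Import complex.
From mathcomp Require Import monalg.
From mathcomp Require Import zify.
Set Implicit Arguments.
Unset Strict Implicit.
Unset Printing Implicit Defensive.
Import Order.TTheory GRing.Theory Num.Theory.
Local Open Scope ring_scope.

(** The product of the group algebra C[K] of an additive group K, [<< c *g k >>]
    being the monomial with coefficient c and exponent k; monalg's own product
    is unavailable since it excludes exponents with opposites. *)
Definition conv (C : comNzRingType) (K : zmodType) (f g : {malg C[K]}) :
    {malg C[K]} :=
  \sum_(a <- msupp f) \sum_(b <- msupp g) << f@_a * g@_b *g (a + b)%R >>.

(** C[z, z^-1]. *)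
Notation laurent C := {malg C[int]}.

(** The span of the f(z_1) conj(g(z_2)): exponent (i, j) stands for
    z_1 ^ i * conj(z_2) ^ j. *)
Notation bilaurent C := {malg C[(int * int)%type]}.

Section Functionals.
Variable C : numClosedFieldType.
Implicit Types (f g L : laurent C) (F : bilaurent C) (u : {scalar bilaurent C}).

Definition zpow (k : int) : laurent C := << 1 *g k >>.

(** f(z_1) conj(g(z_2)). *)
Definition tensor f g : bilaurent C :=
  \sum_(i <- msupp f) \sum_(j <- msupp g) << f@_i * (g@_j)^* *g (i, j) >>.

(** L(z_1) u and u conj(L(z_2)); see [christoffel1E] and [christoffel2E] for
    the values on f(z_1) conj(g(z_2)). *)
Definition christoffel1 L u F : C := u (conv (tensor L (zpow 0)) F).
Definition christoffel2 u L F : C := u (conv F (tensor (zpow 0) L)).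

(** L(z) = L_n z^n + ... + L_{-m} z^{-m} with L_n L_{-m} <> 0. *)
Definition has_degrees (n m : nat) L : Prop :=
  L@_(n%:Z) * L@_(- m%:Z) != 0 /\
  forall j : int, L@_j != 0 -> - m%:Z <= j <= n%:Z.

End Functionals.

Lemma malgU_scale (C : comNzRingType) (K : choiceType) (c x : C) (k : K) :
  << c * x *g k >> = c *: << x *g k >>.
Proof. by apply/malgP => j; rewrite mcoeffZ !mcoeffU mulrnAr. Qed.

Section ConvLemmas.
Variables (C : comNzRingType) (K : zmodType).
Implicit Types f g h : {malg C[K]}.

Lemma convEw (A B : {fset K}) f g : (msupp f `<=` A)%fset ->
  (msupp g `<=` B)%fset ->
  conv f g = \sum_(a <- A) \sum_(b <- B) << f@_a * g@_b *g (a + b)%R >>.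
Proof.
move=> fA gB; rewrite /conv (big_fset_incl _ fA) /=; last first.
  move=> a _ /mcoeff_outdom ->; apply: big1 => b _.
  by rewrite mul0r monalgU0.
apply: eq_bigr => a _; apply: big_fset_incl => // b _ /mcoeff_outdom ->.
by rewrite mulr0 monalgU0.
Qed.

Lemma convC f g : conv f g = conv g f.
Proof.
rewrite /conv exchange_big /=; apply: eq_bigr => b _; apply: eq_bigr => a _.
by rewrite mulrC addrC.
Qed.

Lemma conv_linearr f : linear (conv f).
Proof.
move=> c g h; pose B := (msupp g `|` msupp h `|` msupp (c *: g + h))%fset.
have fA := fsubset_refl (msupp f).
have gB : (msupp g `<=` B)%fset by rewrite /B -fsetUA fsubsetUl.
have hB : (msupp h `<=` B)%fset by rewrite /B -fsetUA fsetUCA fsubsetUl.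
have sB : (msupp (c *: g + h) `<=` B)%fset by rewrite fsubsetUr.
rewrite (convEw fA gB) (convEw fA hB) (convEw fA sB).
rewrite scaler_sumr -big_split /=; apply: eq_bigr => a _.
rewrite scaler_sumr -big_split /=; apply: eq_bigr => b _.
by rewrite -malgU_scale -monalgUD mcoeffD mcoeffZ mulrDr mulrCA.
Qed.

Lemma conv_linearl g : linear (fun f : {malg C[K]} => conv f g : {malg C[K]}).
Proof. by move=> c f h /=; rewrite !(convC _ g) conv_linearr. Qed.

Lemma convUU (x y : C) (a b : K) :
  conv << x *g a >> << y *g b >> = << x * y *g (a + b)%R >>.
Proof.
rewrite (convEw (A := [fset a]%fset) (B := [fset b]%fset)) ?msuppU_le //.
by rewrite !big_seq_fset1 !mcoeffUU.
Qed.

End ConvLemmas.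

HB.instance Definition _ (C : comNzRingType) (K : zmodType) (f : {malg C[K]}) :=
  GRing.isLinear.Build C {malg C[K]} {malg C[K]} *:%R (conv f)
    (conv_linearr f).

Lemma christoffel1_scalar (C : numClosedFieldType) (L : laurent C)
  (u : {scalar bilaurent C}) : scalar (christoffel1 L u).
Proof. by move=> c F G; rewrite /christoffel1 !linearP. Qed.

HB.instance Definition _ (C : numClosedFieldType) (L : laurent C)
    (u : {scalar bilaurent C}) :=
  GRing.isLinear.Build C (bilaurent C) C *%R (christoffel1 L u)
    (christoffel1_scalar L u).

Lemma christoffel2_scalar (C : numClosedFieldType) (L : laurent C)
  (u : {scalar bilaurent C}) : scalar (christoffel2 u L).
Proof.
by move=> c F G; rewrite /christoffel2 !(convC _ (tensor _ _)) !linearP.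
Qed.

HB.instance Definition _ (C : numClosedFieldType) (L : laurent C)
    (u : {scalar bilaurent C}) :=
  GRing.isLinear.Build C (bilaurent C) C *%R (christoffel2 u L)
    (christoffel2_scalar L u).

Section TensorLemmas.
Variable C : numClosedFieldType.
Implicit Types (f g L : laurent C) (u : {scalar bilaurent C}).

Lemma tensorEw (A B : {fset int}) f g : (msupp f `<=` A)%fset ->
  (msupp g `<=` B)%fset ->
  tensor f g = \sum_(a <- A) \sum_(b <- B) << f@_a * (g@_b)^* *g (a, b) >>.
Proof.
move=> fA gB; rewrite /tensor (big_fset_incl _ fA) /=; last first.
  move=> a _ /mcoeff_outdom ->; apply: big1 => b _.
  by rewrite mul0r monalgU0.
apply: eq_bigr => a _; apply: big_fset_incl => // b _ /mcoeff_outdom ->.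
by rewrite rmorph0 mulr0 monalgU0.
Qed.

Lemma mcoeff_tensor f g i j : (tensor f g)@_(i, j) = f@_i * (g@_j)^*.
Proof.
rewrite (tensorEw (A := (i |` msupp f)%fset) (B := (j |` msupp g)%fset));
  rewrite ?fsubsetU1 //.
have ifA : i \in (i |` msupp f)%fset by rewrite fset1U1.
have jgB : j \in (j |` msupp g)%fset by rewrite fset1U1.
rewrite raddf_sum (big_fsetD1 i) //= raddf_sum (big_fsetD1 j) //= mcoeffUU.
rewrite big1_fset ?addr0; last first.
  move=> b; rewrite in_fsetD1 => /andP[bj _] _.
  by rewrite mcoeffU xpair_eqE (negbTE bj) andbF.
rewrite big1_fset ?addr0 // => a; rewrite in_fsetD1 => /andP[ai _] _.
rewrite raddf_sum big1 //= => b _.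
by rewrite mcoeffU xpair_eqE (negbTE ai).
Qed.

Lemma tensor_linearl g : linear (fun f : laurent C => tensor f g : bilaurent C).
Proof.
move=> c f h; apply/malgP => -[i j] /=.
by rewrite !(mcoeffD, mcoeffZ, mcoeff_tensor) mulrDl mulrA.
Qed.

Lemma tensor_antilinearr f c g h :
  tensor f (c *: g + h) = c^* *: tensor f g + tensor f h.
Proof.
apply/malgP => -[i j] /=.
by rewrite !(mcoeffD, mcoeffZ, mcoeff_tensor) rmorphD rmorphM mulrDr mulrCA.
Qed.

Lemma tensorUU (x y : C) i j :
  tensor << x *g i >> << y *g j >> = << x * y^* *g (i, j) >>.
Proof.
apply/malgP => -[i' j']; rewrite mcoeff_tensor !mcoeffU xpair_eqE.
by rewrite rmorphMn /= mulrnAr mulrnAl -!mulrnA mulnb andbC.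
Qed.

Lemma malg_ind (K : choiceType) (P : {malg C[K]} -> Prop) :
  P 0 ->
  (forall c k (f : {malg C[K]}), P f -> P (c *: << 1 *g k >> + f)) ->
  forall f : {malg C[K]}, P f.
Proof.
move=> P0 PD f; rewrite [f]monalgE; elim: (enum_fset (msupp f)) => [|k s IH].
  by rewrite big_nil.
by rewrite big_cons -[f@_k]mulr1 malgU_scale; apply: PD.
Qed.

Lemma conv0f (K : zmodType) (f : {malg C[K]}) : conv 0 f = 0.
Proof. by rewrite convC linear0. Qed.

Lemma tensor0f g : tensor 0 g = 0.
Proof. by apply/malgP => -[i j]; rewrite mcoeff_tensor !mcoeff0 mul0r. Qed.

Lemma tensorf0 f : tensor f 0 = 0.
Proof.
by apply/malgP => -[i j]; rewrite mcoeff_tensor !mcoeff0 rmorph0 mulr0.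
Qed.

Lemma conv_tensor f g f' g' :
  conv (tensor f g) (tensor f' g') = tensor (conv f f') (conv g g').
Proof.
pose U k : laurent C := << 1 *g k >>.
have convZDl (K : zmodType) c (x y z : {malg C[K]}) :
  conv (c *: x + y) z = c *: conv x z + conv y z := conv_linearl z c x y.
have convZDr (K : zmodType) c (x y z : {malg C[K]}) :
  conv x (c *: y + z) = c *: conv x y + conv x z := conv_linearr x c y z.
have tensZDl c (x y z : laurent C) :
  tensor (c *: x + y) z = c *: tensor x z + tensor y z
  := tensor_linearl z c x y.
have convf0 (K : zmodType) (x : {malg C[K]}) : conv x 0 = 0.
  by rewrite convC conv0f.
have E0 i j i' j' : conv (tensor (U i) (U j)) (tensor (U i') (U j')) =
    tensor (conv (U i) (U i')) (conv (U j) (U j')).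
  by rewrite /U !tensorUU !convUU tensorUU !(mulr1, rmorph1).
have E1 i j i' : conv (tensor (U i) (U j)) (tensor (U i') g') =
    tensor (conv (U i) (U i')) (conv (U j) g').
  elim/malg_ind: g' => [|c k x IH]; first by rewrite tensorf0 !convf0 tensorf0.
  by rewrite tensor_antilinearr !convZDr tensor_antilinearr IH E0.
have E2 i j : conv (tensor (U i) (U j)) (tensor f' g') =
    tensor (conv (U i) f') (conv (U j) g').
  elim/malg_ind: f' => [|c k x IH]; first by rewrite tensor0f !convf0 tensor0f.
  by rewrite tensZDl !convZDr tensZDl IH E1.
have E3 i : conv (tensor (U i) g) (tensor f' g') =
    tensor (conv (U i) f') (conv g g').
  elim/malg_ind: g => [|c k x IH]; first by rewrite tensorf0 !conv0f tensorf0.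
  by rewrite tensor_antilinearr !convZDl tensor_antilinearr IH E2.
elim/malg_ind: f => [|c k x IH]; first by rewrite tensor0f !conv0f tensor0f.
by rewrite tensZDl !convZDl tensZDl IH E3.
Qed.

Lemma conv1f f : conv (zpow C 0) f = f.
Proof.
elim/malg_ind: f => [|c i f IHf]; first by rewrite linear0.
by rewrite conv_linearr IHf convUU mul1r add0r.
Qed.

Lemma christoffel1E L u f g :
  christoffel1 L u (tensor f g) = u (tensor (conv L f) g).
Proof. by rewrite /christoffel1 conv_tensor conv1f. Qed.

Lemma christoffel2E L u f g :
  christoffel2 u L (tensor f g) = u (tensor f (conv L g)).
Proof. by rewrite /christoffel2 conv_tensor (convC f) conv1f convC. Qed.

End TensorLemmas.

(** Semi-infinite matrices, indexed from 0. *)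
Notation smx C := (nat -> nat -> C).

Section SemiInfinite.
Variable C : numClosedFieldType.
Implicit Types A B H S G : smx C.

Definition smx1 : smx C := fun i j => (i == j)%:R.

(** An entry given by a sum with infinitely many nonzero terms is 0 by
    convention. *)
Definition smul A B : smx C := fun i j => \sum_(k \in setT) A i k * B k j.

(** An inverse of a lower unitriangular matrix is unique and lower
    unitriangular, and it exists: see [lower_unitri_inv] and [smul1_uniq]
    below. The value is 0 for a matrix without inverse. *)
Definition sinv A : smx C :=
  xget (fun _ _ => 0) [set B | smul A B = smx1 /\ smul B A = smx1]%classic.

Definition strans A : smx C := fun i j => A j i.
Definition sdagger A : smx C := fun i j => (A j i)^*.

Definition lower_unitri A : Prop :=
  (forall i, A i i = 1) /\ (forall i j, (i < j)%N -> A i j = 0).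

Definition diagonal_nonzero H : Prop :=
  (forall i, H i i != 0) /\ (forall i j, i != j -> H i j = 0).

Definition quasidefinite G : Prop :=
  forall k, \det (\matrix_(i < k, j < k) G i j) != 0.

(** G = S1^-1 H (S2^-1)^dagger. *)
Definition is_LDU G S1 H S2 : Prop :=
  [/\ lower_unitri S1, lower_unitri S2, diagonal_nonzero H &
      G = smul (smul (sinv S1) H) (sdagger (sinv S2))].

Definition upper_banded (w : nat) A : Prop :=
  forall k j, ~~ (k <= j <= k + w)%N -> A k j = 0.

Definition lower_unitri_banded (w : nat) A : Prop :=
  lower_unitri A /\ forall k j, ~~ (j <= k <= j + w)%N -> A k j = 0.

(** The exponents 0, -1, 1, -2, 2, ... of the CMV sequence [chi]. *)
Definition chi_exp (k : nat) : int := if odd k then - (k./2.+1)%:Z else k./2%:Z.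
Definition chi (k : nat) : laurent C := zpow C (chi_exp k).

Definition Upsilon : smx C := fun i j =>
  [|| ~~ odd i && (j == i.+2), (i == 1%N) && (j == 0%N)
    | odd j && (i == j.+2)]%:R.

(** Integer powers, with Upsilon^-1 = Upsilon^T: see [Upsilon_transr] and
    [Upsilon_transl] below. *)
Definition Upsilonz (p : int) : smx C :=
  match p with
  | Posz q => iter q (smul Upsilon) smx1
  | Negz q => iter q.+1 (smul (strans Upsilon)) smx1
  end.

Definition laurent_smx (L : laurent C) : smx C :=
  fun i j => \sum_(p <- msupp L) L@_p * Upsilonz p i j.

Definition gram (u : {scalar bilaurent C}) : smx C :=
  fun k l => u (tensor (chi k) (chi l)).

End SemiInfinite.

Section SemiInfiniteLemmas.
Variable C : numClosedFieldType.
Implicit Types A B D : smx C.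

Lemma fsum_nat (N : nat) (F : nat -> C) : (forall k, (N <= k)%N -> F k = 0) ->
  \sum_(k \in setT) F k = \sum_(k < N) F k.
Proof.
move=> F0; rewrite fsbig_ord; symmetry; apply: fsbig_widen => //.
by move=> k [_ /= /negP]; rewrite -leqNgt => /F0.
Qed.

Lemma smul_lowerl (N i : nat) A B j : lower_unitri A -> (i < N)%N ->
  smul A B i j = \sum_(k < N) A i k * B k j.
Proof.
move=> [_ A0] iN; apply: fsum_nat => k Nk.
by rewrite A0 ?mul0r // (leq_trans iN).
Qed.

Lemma smul_lower_rec i A B j : lower_unitri A ->
  smul A B i j = \sum_(k < i) A i k * B k j + B i j.
Proof.
move=> lA; rewrite (smul_lowerl B j lA (ltnSn i)) big_ord_recr /=.
by rewrite lA.1 mul1r.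
Qed.

Lemma smul1_uniq A B D : lower_unitri A ->
  smul A B = smx1 C -> smul A D = smx1 C -> B = D.
Proof.
move=> lA AB AD; apply/funext => i; apply/funext => j.
elim/ltn_ind: i => i IH.
have /(congr1 (fun X => X i j)) := etrans AB (esym AD).
rewrite /= !(smul_lower_rec i _ j lA).
under eq_bigr => k _ do rewrite (IH k (ltn_ord k)).
exact: addrI.
Qed.

Fixpoint rinv_rows A (n : nat) : smx C :=
  if n is n'.+1 then fun i j =>
    if i == n' then (i == j)%:R - \sum_(k < n') A i k * rinv_rows A n' k j
    else rinv_rows A n' i j
  else fun _ _ => 0.

Lemma rinv_rows_stable A n i j : (i < n)%N ->
  rinv_rows A n i j = rinv_rows A i.+1 i j.
Proof.
elim: n => // n IH; rewrite ltnS leq_eqVlt => /orP[/eqP-> //|lt_in].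
by rewrite [LHS]/= ltn_eqF // IH.
Qed.

Lemma rinv_exists A : lower_unitri A ->
  exists2 B : smx C, lower_unitri B & smul A B = smx1 C.
Proof.
move=> lA; pose B i j := rinv_rows A i.+1 i j.
have BE i j : B i j = (i == j)%:R - \sum_(k < i) A i k * B k j.
  rewrite /B /= eqxx; congr (_ - _); apply: eq_bigr => k _.
  by rewrite rinv_rows_stable.
have B0 i j : (i < j)%N -> B i j = 0.
  elim/ltn_ind: i j => i IH j ij; rewrite BE ltn_eqF // sub0r big1 ?oppr0 //.
  by move=> k _; rewrite (IH k) ?mulr0 // (ltn_trans _ ij).
exists B.
  split=> // i; rewrite BE eqxx big1 ?subr0 // => k _.
  by rewrite B0 ?mulr0.
apply/funext => i; apply/funext => j.
by rewrite smul_lower_rec // [B i j]BE addrC subrK.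
Qed.

Lemma smul_lower_lower A B : lower_unitri A -> lower_unitri B ->
  lower_unitri (smul A B).
Proof.
move=> lA lB; split=> [i|i j ij]; rewrite smul_lower_rec //.
  by rewrite lB.1 big1 ?add0r // => k _; rewrite lB.2 ?mulr0.
rewrite lB.2 // addr0 big1 // => k _.
by rewrite lB.2 ?mulr0 // (ltn_trans _ ij).
Qed.

Lemma smulA_lower A B D : lower_unitri A -> lower_unitri B ->
  smul A (smul B D) = smul (smul A B) D.
Proof.
move=> lA lB; apply/funext => i; apply/funext => j.
rewrite (smul_lowerl _ j lA (ltnSn i)).
rewrite (smul_lowerl _ j (smul_lower_lower lA lB) (ltnSn i)).
under eq_bigr => k _ do rewrite (smul_lowerl D j lB (ltn_ord k)) mulr_sumr.
rewrite exchange_big /=; apply: eq_bigr => l _.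
rewrite (smul_lowerl B l lA (ltnSn i)) mulr_suml.
by apply: eq_bigr => k _; rewrite mulrA.
Qed.

Lemma smul1m A : smul (smx1 C) A = A.
Proof.
apply/funext => i; apply/funext => j.
have l1 : lower_unitri (smx1 C).
  by split=> [k|k l kl]; rewrite /smx1 ?eqxx // ltn_eqF.
rewrite smul_lower_rec // big1 ?add0r // => k _.
by rewrite /smx1 gtn_eqF ?mul0r.
Qed.

Lemma smulm1 A : smul A (smx1 C) = A.
Proof.
apply/funext => i; apply/funext => j.
rewrite /smul (fsum_nat (N := j.+1)) => [|k jk]; last first.
  by rewrite /smx1 gtn_eqF ?mulr0.
rewrite big_ord_recr /= /smx1 eqxx mulr1 big1 ?add0r // => k _.
by rewrite ltn_eqF ?mulr0.
Qed.

Lemma lower_unitri_inv A : lower_unitri A ->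
  [/\ lower_unitri (sinv A), smul A (sinv A) = smx1 C &
      smul (sinv A) A = smx1 C].
Proof.
move=> lA; have [B lB AB] := rinv_exists lA; have [D lD BD] := rinv_exists lB.
have AD : A = D by rewrite -[A]smulm1 -BD smulA_lower // AB smul1m.
have BA : smul B A = smx1 C by rewrite AD.
rewrite /sinv; case: xgetP => [X XE [AX XA]|/(_ B)[]//].
by have <- := smul1_uniq lA AB AX.
Qed.

Lemma chi_exp_inj : injective chi_exp.
Proof.
move=> i j; rewrite /chi_exp.
by have [oi|ei] := boolP (odd i); have [oj|ej] := boolP (odd j); lia.
Qed.

Lemma Upsilon_rowE i : exists k : nat,
  chi_exp k = chi_exp i + 1 /\ forall j, Upsilon C i j = (j == k)%:R.
Proof.
have [oi|ei] := boolP (odd i); last first.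
  exists i.+2; rewrite /chi_exp /= negbK (negbTE ei); split; first by lia.
  move=> j; rewrite /Upsilon ei /=; congr (_ : bool)%:R; lia.
have [->|i1] := eqVneq i 1%N.
  by exists 0%N; split=> // j; rewrite /Upsilon /=; congr (_ : bool)%:R; lia.
exists (i - 2)%N; rewrite /chi_exp oi; split.
  have -> : odd (i - 2) by lia.
  lia.
by move=> j; rewrite /Upsilon oi; congr (_ : bool)%:R; lia.
Qed.

(** Upsilon chi(z) = z chi(z). *)
Lemma Upsilon_chi i (l : int) :
  \sum_(j \in setT) Upsilon C i j * (chi C j)@_l = (conv (zpow C 1) (chi C i))@_l.
Proof.
have [k [kE UE]] := Upsilon_rowE i.
rewrite convUU mulr1 addrC -kE (fsum_nat (N := k.+1)) => [|j kj]; last first.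
  by rewrite UE gtn_eqF ?mul0r.
rewrite big_ord_recr /= UE eqxx mul1r big1 ?add0r // => j _.
by rewrite UE ltn_eqF ?mul0r.
Qed.

Lemma Upsilon_colE j : exists k : nat,
  chi_exp k = chi_exp j - 1 /\ forall i, Upsilon C i j = (i == k)%:R.
Proof.
have [oj|ej] := boolP (odd j).
  exists j.+2; rewrite /chi_exp /= negbK oj; split; first by lia.
  move=> i; rewrite /Upsilon oj /=; congr (_ : bool)%:R; lia.
have [->|j0] := eqVneq j 0%N.
  by exists 1%N; split=> // i; rewrite /Upsilon /=; congr (_ : bool)%:R; lia.
exists (j - 2)%N; rewrite /chi_exp (negbTE ej); split.
  have -> : odd (j - 2) = false by lia.
  lia.
by move=> i; rewrite /Upsilon (negbTE ej); congr (_ : bool)%:R; lia.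
Qed.

Lemma Upsilon_transr : smul (Upsilon C) (strans (Upsilon C)) = smx1 C.
Proof.
apply/funext => i; apply/funext => i'.
have [k [kE UE]] := Upsilon_rowE i; have [k' [kE' UE']] := Upsilon_rowE i'.
rewrite /smul /strans (fsum_nat (N := k.+1)) => [|j kj]; last first.
  by rewrite UE gtn_eqF ?mul0r.
rewrite big_ord_recr /= UE eqxx mul1r big1 ?add0r => [|j _]; last first.
  by rewrite UE ltn_eqF ?mul0r.
rewrite UE' /smx1; congr (_ : bool)%:R.
by rewrite -(inj_eq chi_exp_inj) kE kE' (inj_eq (addIr _)) (inj_eq chi_exp_inj).
Qed.

Lemma Upsilon_transl : smul (strans (Upsilon C)) (Upsilon C) = smx1 C.
Proof.
apply/funext => i; apply/funext => i'.
have [k [kE UE]] := Upsilon_colE i; have [k' [kE' UE']] := Upsilon_colE i'.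
rewrite /smul /strans (fsum_nat (N := k.+1)) => [|j kj]; last first.
  by rewrite UE gtn_eqF ?mul0r.
rewrite big_ord_recr /= UE eqxx mul1r big1 ?add0r => [|j _]; last first.
  by rewrite UE ltn_eqF ?mul0r.
rewrite UE' /smx1; congr (_ : bool)%:R.
by rewrite -(inj_eq chi_exp_inj) kE kE' (inj_eq (addIr _)) (inj_eq chi_exp_inj).
Qed.

End SemiInfiniteLemmas.

(* Main.v *)
Require Import Defs.
From mathcomp Require Import all_boot all_order all_algebra.
From mathcomp Require Import reals complex monalg.
From mathcomp Require Import boolp zify.
Set Implicit Arguments.
Unset Strict Implicit.
Unset Printing Implicit Defensive.
Import Order.TTheory GRing.Theory Num.Theory.
Local Open Scope ring_scope.

(** The CMV matrix L(Upsilon) represents multiplication by L on the CMV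
    sequence, that is L chi_k = sum_j L(Upsilon)_(k,j) chi_j.  Hence the first
    Christoffel transformation multiplies the Gram matrix on the left:
    G^ = L(Upsilon) G ([gram_christoffel1]).  Moreover
    L(Upsilon)_(k,j) = L_(e_j - e_k) with e the sequence 0, -1, 1, -2, 2, ...
    ([laurent_smxE]), and |j - k| <= 2 |e_j - e_k|, so L(Upsilon) vanishes
    beyond its first 2 max(n,m) superdiagonals ([laurent_smx_upper_bw]).

    Equating the triangular factorizations of G^ and of L(Upsilon) G gives
<<
      (S^_1 L(Upsilon) S_1^-1) H = H^ (S_2 S^_2^-1)^dagger
>>
    ([connector_eq]).  The left connector is a product of matrices with
    bounded upper bandwidth, so it vanishes beyond 2 max(n,m) superdiagonals;
    the right-hand side is upper triangular.  As the diagonal entries of H and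
    H^ are nonzero, each connector inherits the zeros of both sides
    ([connectors_banded]).

    The second transformation reads G^^dagger = L(Upsilon) G^dagger
    ([gram_christoffel2]).  Since the adjoint of a factorized matrix is
    factorized with S_1 and S_2 exchanged ([is_LDU_dagger]), the same
    argument applies to it.

    Products of semi-infinite matrices are not associative in general.  Each
    regrouping used here is that of a product A B D in which A has bounded
    upper bandwidth and so does either B ([smulA_row]) or the transpose of D
    ([smulA_rowcol]): then all the sums involved are finite. *)

(** * Semi-infinite matrices of bounded upper bandwidth *)
Section UpperBandwidth.
Variable C : numClosedFieldType.
Implicit Types A B D S H G M : smx C.

(** Bounded on one side only, so that lower triangular, diagonal and banded
    matrices are all covered and the bandwidths of a product add up. *)
Definition upper_bw (w : nat) A : Prop :=
  forall i j, (i + w < j)%N -> A i j = 0.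

Lemma lower_unitri_upper_bw A : lower_unitri A -> upper_bw 0 A.
Proof. by move=> [_ A0] i j; rewrite addn0 => /A0. Qed.

Lemma diagonal_upper_bw H : diagonal_nonzero H -> upper_bw 0 H.
Proof. by move=> [_ H0] i j; rewrite addn0 => ij; rewrite H0 // ltn_eqF. Qed.

Lemma smul_upper_bwE (w N : nat) A B i j : upper_bw w A -> (i + w < N)%N ->
  smul A B i j = \sum_(k < N) A i k * B k j.
Proof.
by move=> wA iN; apply: fsum_nat => k Nk; rewrite wA ?mul0r // (leq_trans iN).
Qed.

Lemma smul_upper_bw (v w : nat) A B :
  upper_bw v A -> upper_bw w B -> upper_bw (v + w) (smul A B).
Proof.
move=> vA wB i j ij; rewrite (smul_upper_bwE _ j vA (ltnSn _)) big1 // => k _.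
by rewrite wB ?mulr0 //; have := ltn_ord k; lia.
Qed.

Lemma smulA_row (v w : nat) A B D : upper_bw v A -> upper_bw w B ->
  smul A (smul B D) = smul (smul A B) D.
Proof.
move=> vA wB; apply/funext => i; apply/funext => j.
rewrite (smul_upper_bwE _ j vA (ltnSn _)).
rewrite (smul_upper_bwE D j (smul_upper_bw vA wB) (ltnSn _)).
under eq_bigr => k _.
  rewrite (smul_upper_bwE (N := (i + (v + w)).+1) D j wB); last first.
    by have := ltn_ord k; lia.
  rewrite mulr_sumr; over.
rewrite exchange_big /=; apply: eq_bigr => l _.
rewrite (smul_upper_bwE _ l vA (ltnSn _)) mulr_suml.
by apply: eq_bigr => k _; rewrite mulrA.
Qed.

Lemma smulA_rowcol (v w : nat) A B D : upper_bw v A -> upper_bw w (strans D) ->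
  smul A (smul B D) = smul (smul A B) D.
Proof.
move=> vA wD; apply/funext => i; apply/funext => j.
have smulDE X k : smul X D k j = \sum_(l < (j + w).+1) X k l * D l j.
  by apply: fsum_nat => l jl; rewrite [D l j](wD j l) // mulr0.
rewrite smulDE (smul_upper_bwE _ j vA (ltnSn _)).
under eq_bigr => k _ do rewrite smulDE mulr_sumr.
rewrite exchange_big /=; apply: eq_bigr => l _.
rewrite (smul_upper_bwE _ l vA (ltnSn _)) mulr_suml.
by apply: eq_bigr => k _; rewrite mulrA.
Qed.

Lemma smul_dagger (w : nat) A B : upper_bw w A ->
  sdagger (smul A B) = smul (sdagger B) (sdagger A).
Proof.
move=> wA; apply/funext => i; apply/funext => j.
rewrite /sdagger (smul_upper_bwE _ _ wA (ltnSn _)) rmorph_sum /=.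
rewrite /smul (fsum_nat (N := (j + w).+1)) => [|k jk]; last first.
  by rewrite (wA j k) // rmorph0 mulr0.
by apply: eq_bigr => k _; rewrite rmorphM mulrC.
Qed.

Lemma sdaggerK A : sdagger (sdagger A) = A.
Proof. by apply/funext => i; apply/funext => j; apply: conjCK. Qed.

Lemma sdagger1 : sdagger (smx1 C) = smx1 C.
Proof.
by apply/funext => i; apply/funext => j; rewrite /sdagger /smx1 rmorph_nat eq_sym.
Qed.

Lemma lower_unitri_dagger_col A :
  lower_unitri A -> upper_bw 0 (strans (sdagger A)).
Proof.
move=> lA i j ij; rewrite /strans /sdagger.
by rewrite (lower_unitri_upper_bw lA ij) rmorph0.
Qed.

Lemma smul_diagl H A i j : diagonal_nonzero H ->
  smul H A i j = H i i * A i j.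
Proof.
move=> dH; have bH := diagonal_upper_bw dH.
rewrite (smul_upper_bwE (N := i.+1) A j bH) ?addn0 // big_ord_recr /=.
by rewrite big1 ?add0r // => k _; rewrite dH.2 ?mul0r // gtn_eqF.
Qed.

Lemma smul_diagr H A i j : diagonal_nonzero H ->
  smul A H i j = A i j * H j j.
Proof.
move=> dH; rewrite /smul (fsum_nat (N := j.+1)) => [|k jk]; last first.
  by rewrite dH.2 ?mulr0 // gtn_eqF.
rewrite big_ord_recr /= big1 ?add0r // => k _.
by rewrite dH.2 ?mulr0 // ltn_eqF.
Qed.

(** * Connectors of two triangular factorizations *)

(** Exchanging the two triangular factors turns statements about the second
    transformation into statements about the first. *)
Lemma is_LDU_dagger G S1 H S2 :
  is_LDU G S1 H S2 -> is_LDU (sdagger G) S2 (sdagger H) S1.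
Proof.
move=> [l1 l2 dH ->].
have [i1 _ _] := lower_unitri_inv l1; have [i2 _ _] := lower_unitri_inv l2.
have bH := diagonal_upper_bw dH.
have b1 := lower_unitri_upper_bw i1; have b2 := lower_unitri_upper_bw i2.
have dH' : diagonal_nonzero (sdagger H).
  split=> [i|i j ij]; first by rewrite /sdagger fmorph_eq0 dH.1.
  by rewrite /sdagger dH.2 ?rmorph0 // eq_sym.
split=> //.
rewrite (smul_dagger _ (smul_upper_bw b1 bH)) sdaggerK (smul_dagger _ b1).
exact: smulA_row b2 (diagonal_upper_bw dH').
Qed.

(** Cancelling the outer factors of
    S^_1^-1 H^ (S^_2^-1)^dagger = M S_1^-1 H (S_2^-1)^dagger, by S^_1 on the
    left and by S_2^dagger on the right. *)
Lemma connector_eq (w : nat) G M S1 H S2 T1 K T2 : upper_bw w M ->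
  is_LDU G S1 H S2 -> is_LDU (smul M G) T1 K T2 ->
  smul (smul (smul T1 M) (sinv S1)) H = smul K (sdagger (smul S2 (sinv T2))).
Proof.
move=> bM [l1 l2 dH GE] [lt1 lt2 dK MGE].
have [i1 _ _] := lower_unitri_inv l1; have [_ S2K _] := lower_unitri_inv l2.
have [it1 T1K _] := lower_unitri_inv lt1;
have bH := diagonal_upper_bw dH; have bK := diagonal_upper_bw dK.
have b1 := lower_unitri_upper_bw i1; have b2 := lower_unitri_upper_bw l2.
have bt := lower_unitri_upper_bw lt1; have bi := lower_unitri_upper_bw it1.
have cS2 := lower_unitri_dagger_col l2.
have bTM := smul_upper_bw bt bM.
have GS2 : smul G (sdagger S2) = smul (sinv S1) H.
  rewrite GE -(smulA_rowcol _ (smul_upper_bw b1 bH) cS2).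
  by rewrite -(smul_dagger _ b2) S2K sdagger1 smulm1.
have TMG : smul (smul T1 M) G = smul K (sdagger (sinv T2)).
  rewrite -(smulA_row _ bt bM) MGE (smulA_row _ bt (smul_upper_bw bi bK)).
  by rewrite (smulA_row _ bt bi) T1K smul1m.
rewrite -(smulA_row _ bTM b1) -GS2 (smulA_rowcol _ bTM cS2) TMG.
by rewrite -(smulA_rowcol _ bK cS2) -(smul_dagger _ b2).
Qed.

(** In om1 H = K om2^dagger the left side has bounded upper bandwidth and the
    right side is upper triangular; entrywise,
    om1_(i,j) H_j = K_i conj(om2_(j,i)) carries the zeros from one connector
    to the other. *)
Lemma connectors_banded (w : nat) G M S1 H S2 T1 K T2 : upper_bw w M ->
  is_LDU G S1 H S2 -> is_LDU (smul M G) T1 K T2 ->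
  upper_banded w (smul (smul T1 M) (sinv S1)) /\
  lower_unitri_banded w (smul S2 (sinv T2)).
Proof.
move=> bM fG fMG; have E := connector_eq bM fG fMG.
case: fG fMG => [l1 l2 dH _] [lt1 lt2 dK _].
have [i1 _ _] := lower_unitri_inv l1; have [it2 _ _] := lower_unitri_inv lt2.
set om1 := smul (smul T1 M) (sinv S1) in E *.
set om2 := smul S2 (sinv T2) in E *.
have lom2 : lower_unitri om2 by apply: smul_lower_lower.
have bom1 : upper_bw w om1.
  rewrite -[w]addn0 -[w in (w + 0)%N]add0n; apply: smul_upper_bw.
    exact: smul_upper_bw (lower_unitri_upper_bw lt1) bM.
  exact: lower_unitri_upper_bw.
have Eij i j : om1 i j * H j j = K i i * (om2 j i)^*.
  by rewrite -(smul_diagr _ _ _ dH) E (smul_diagl _ _ _ dK).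
split; last split=> //.
  move=> k j; rewrite negb_and -!ltnNge => /orP[jk|]; last exact: bom1.
  apply: (mulIf (dH.1 j)).
  by rewrite Eij lom2.2 // rmorph0 mulr0 mul0r.
move=> k j; rewrite negb_and -!ltnNge => /orP[kj|jk]; first exact: lom2.2.
apply/eqP; rewrite -conjC_eq0; apply/eqP; apply: (mulfI (dK.1 j)).
by rewrite -Eij bom1 // mulr0 mul0r.
Qed.

End UpperBandwidth.

(** * The CMV matrix of a Laurent polynomial *)
Section CMV.
Variable C : numClosedFieldType.
Implicit Types (L f : laurent C) (u : {scalar bilaurent C}).

Lemma smul_UpsilonE (A : smx C) i k j :
  chi_exp k = chi_exp i + 1 -> smul (Upsilon C) A i j = A k j.
Proof.
have [k' [kE UE]] := Upsilon_rowE C i.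
move=> kE'; have {kE'} -> : k = k' by apply: chi_exp_inj; rewrite kE' kE.
rewrite /smul (fsum_nat (N := k'.+1)) => [|l kl]; last first.
  by rewrite UE gtn_eqF ?mul0r.
rewrite big_ord_recr /= UE eqxx mul1r big1 ?add0r // => l _.
by rewrite UE ltn_eqF ?mul0r.
Qed.

Lemma smul_strans_UpsilonE (A : smx C) i k j :
  chi_exp k = chi_exp i - 1 -> smul (strans (Upsilon C)) A i j = A k j.
Proof.
have [k' [kE UE]] := Upsilon_colE C i.
move=> kE'; have {kE'} -> : k = k' by apply: chi_exp_inj; rewrite kE' kE.
rewrite /smul /strans (fsum_nat (N := k'.+1)) => [|l kl]; last first.
  by rewrite UE gtn_eqF ?mul0r.
rewrite big_ord_recr /= UE eqxx mul1r big1 ?add0r // => l _.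
by rewrite UE ltn_eqF ?mul0r.
Qed.

Lemma chi_exp_surj (e : int) : exists k, chi_exp k = e.
Proof.
case: e => q; first by exists q.*2; rewrite /chi_exp odd_double doubleK.
by exists q.*2.+1; rewrite /chi_exp /= odd_double /= uphalf_double NegzE.
Qed.

Lemma UpsilonzE (p : int) i j :
  Upsilonz C p i j = (chi_exp j == chi_exp i + p)%:R.
Proof.
case: p => q /=.
  elim: q i => [|q IH] i.
    by rewrite /= /smx1 addr0 eq_sym (inj_eq chi_exp_inj).
  have [k kE] := chi_exp_surj (chi_exp i + 1).
  by rewrite iterS (smul_UpsilonE _ _ kE) IH kE; congr (_ : bool)%:R; lia.
rewrite -iterS NegzE.
elim: q.+1 i => [|p IH] i.
  by rewrite /= /smx1 oppr0 addr0 eq_sym (inj_eq chi_exp_inj).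
have [k kE] := chi_exp_surj (chi_exp i - 1).
by rewrite iterS (smul_strans_UpsilonE _ _ kE) IH kE; congr (_ : bool)%:R; lia.
Qed.

Lemma laurent_smxE L i j : laurent_smx L i j = L@_(chi_exp j - chi_exp i).
Proof.
rewrite /laurent_smx [in RHS](monalgE L) raddf_sum /=.
apply: eq_bigr => p _; rewrite UpsilonzE mcoeffU -[RHS]mulr_natr.
by congr (_ * (_ : bool)%:R); lia.
Qed.

(** Positions of equal parity hold exponents of the same sign, at half the
    distance; positions of opposite parity hold exponents on both sides of
    -1/2, which are even further apart. *)
Lemma leq_chi_exp_dist i j : (j <= i + 2 * `|chi_exp j - chi_exp i|)%N.
Proof.
rewrite /chi_exp; have [oi|ei] := boolP (odd i);
  have [oj|ej] := boolP (odd j); lia.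
Qed.

Lemma laurent_smx_upper_bw (n m : nat) L : has_degrees n m L ->
  upper_bw (2 * maxn n m) (laurent_smx L).
Proof.
move=> [_ degL] i j ij; rewrite laurent_smxE; apply/eqP/contraT => /degL.
by have := leq_chi_exp_dist i j; lia.
Qed.

Lemma mcoeff_conv_zpow f (e q : int) : (conv f (zpow C e))@_q = f@_(q - e).
Proof.
elim/malg_ind: f => [|c k f IH]; first by rewrite conv0f !mcoeff0.
have -> : conv (c *: << 1 *g k >> + f) (zpow C e) =
    c *: conv << 1 *g k >> (zpow C e) + conv f (zpow C e) := conv_linearl _ _ _ _.
rewrite convUU mulr1 !(mcoeffD, mcoeffZ) IH !mcoeffU.
by congr (c * (_ : bool)%:R + _); lia.
Qed.

(** Row k of L(Upsilon) chi = L chi.  The sum is cut off past the bandwidth so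
    that a linear functional can be applied to it term by term. *)
Lemma conv_chiE (w N : nat) L k : upper_bw w (laurent_smx L) ->
  (k + w < N)%N ->
  conv L (chi C k) = \sum_(j < N) laurent_smx L k j *: chi C j.
Proof.
move=> bL kN; apply/malgP => q; have [i <-] := chi_exp_surj q.
rewrite mcoeff_conv_zpow -laurent_smxE raddf_sum /=.
under eq_bigr => j _ do
  rewrite mcoeffZ mcoeffU (inj_eq chi_exp_inj) mulr_natr.
have [iN|Ni] := ltnP i N.
  rewrite (bigD1 (Ordinal iN)) //= eqxx mulr1n big1 ?addr0 // => j.
  by rewrite -val_eqE /= => /negbTE->.
rewrite bL ?(leq_trans kN) // big1 // => j _.
by rewrite ltn_eqF // (leq_trans (ltn_ord j)).
Qed.

Lemma gram_christoffel1 (w : nat) L u : upper_bw w (laurent_smx L) ->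
  gram (christoffel1 L u) = smul (laurent_smx L) (gram u).
Proof.
move=> bL; apply/funext => k; apply/funext => l.
rewrite (smul_upper_bwE _ l bL (ltnSn _)) /gram /= christoffel1E.
rewrite (conv_chiE bL (ltnSn _)).
elim: (k + w).+1 => [|N IH]; first by rewrite !big_ord0 tensor0f linear0.
rewrite !big_ord_recr /= -IH [X in tensor X _]addrC [RHS]addrC.
have tensZDl x (y z : laurent C) : tensor (x *: y + z) (chi C l) =
    x *: tensor y (chi C l) + tensor z (chi C l) := tensor_linearl _ _ _ _.
by rewrite tensZDl linearP.
Qed.

Lemma gram_christoffel2 (w : nat) L u : upper_bw w (laurent_smx L) ->
  sdagger (gram (christoffel2 u L)) = smul (laurent_smx L) (sdagger (gram u)).
Proof.
move=> bL; apply/funext => k; apply/funext => l.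
rewrite (smul_upper_bwE _ l bL (ltnSn _)) /sdagger /gram /= christoffel2E.
rewrite (conv_chiE bL (ltnSn _)).
elim: (k + w).+1 => [|N IH].
  by rewrite !big_ord0 tensorf0 linear0 rmorph0.
rewrite !big_ord_recr /= -IH [X in tensor _ X]addrC [RHS]addrC.
by rewrite tensor_antilinearr linearP rmorphD rmorphM /= conjCK.
Qed.

End CMV.

(* hSab and hHa stand for \hat S^{(a)}_b and \hat H^{(a)}. *)
Theorem proposition9 (R : realType) (u : {scalar bilaurent R[i]})
  (n m : nat) (L1 L2 : laurent R[i])
  (hL1 : has_degrees n m L1) (hL2 : has_degrees n m L2)
  (qG : quasidefinite (gram u))
  (qG1 : quasidefinite (gram (christoffel1 L1 u)))
  (qG2 : quasidefinite (gram (christoffel2 u L2)))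
  (S1 S2 H hS11 hS12 hH1 hS21 hS22 hH2 : smx R[i])
  (fG : is_LDU (gram u) S1 H S2)
  (fG1 : is_LDU (gram (christoffel1 L1 u)) hS11 hH1 hS12)
  (fG2 : is_LDU (gram (christoffel2 u L2)) hS21 hH2 hS22) :
  [/\ upper_banded (2 * maxn n m)
        (smul (smul hS11 (laurent_smx L1)) (sinv S1)),
      lower_unitri_banded (2 * maxn n m) (smul S2 (sinv hS12)),
      lower_unitri_banded (2 * maxn n m) (smul S1 (sinv hS21)) &
      upper_banded (2 * maxn n m)
        (smul (smul hS22 (laurent_smx L2)) (sinv S2))].
Proof.
have b1 := laurent_smx_upper_bw hL1; have b2 := laurent_smx_upper_bw hL2.
move: fG1; rewrite (gram_christoffel1 _ b1) => fG1.
move/is_LDU_dagger: fG2; rewrite (gram_christoffel2 _ b2) => fG2.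
have [om11 om12] := connectors_banded b1 fG fG1.
by have [om22 om21] := connectors_banded b2 (is_LDU_dagger fG) fG2.
Qed.
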